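(* Let $X=\{X(t),t\in\mathbb{R}^N\}$ be a centered real-valued Gaussian random field with stationary increments and variogram $v(h)=\mathbb{E}(X(t+h)-X(t))^2$. If all the second-order partial and mixed derivatives of $v$ exist and are continuous on $\mathbb{R}^N$, then $X$ is mean square differentiable at every $t\in\mathbb{R}^N$.
   Context: $X$ satisfies $X(0)=0$ and has a continuous covariance function given by $\mathbb{E}[X(s)X(t)]=\int_{\mathbb{R}^N}(e^{i\langle s,\lambda\rangle}-1)(e^{-i\langle t,\lambda\rangle}-1)F(d\lambda)$, where $F$ is a nonnegative symmetric measure on $\mathbb{R}^N\setminus\{0\}$ with $\int\frac{|\lambda|^2}{1+|\lambda|^2}F(d\lambda)<\infty$. Definition: a random field $\{X(t),t\in\mathbb{R}^N\}$ is mean square differentiable at $t$ if there is a random vector $\nabla_X(t)\in\mathbb{R}^N$ such that for all scalars $h>0$ and all unit vectors $u\in\mathbb{R}^N$, $X(t+hu)=X(t)+hu^T\nabla_X(t)+r(t,hu)$, where $r(t,hu)/h\to0$ in $L^2$ as $h\to0$; i.e. for every unit vector $u$, $\lim_{h\to0}\mathbb{E}\Big(\frac{X(t+hu)-X(t)-hu^T\nabla_X(t)}{h}\Big)^2=0$. *)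

(* Defs.v *)
From mathcomp Require Import all_boot all_order all_algebra.
From mathcomp Require Import complex.
From mathcomp Require Import all_classical all_reals all_analysis.

Set Implicit Arguments.
Unset Strict Implicit.
Unset Printing Implicit Defensive.

Import Order.TTheory GRing.Theory Num.Theory.
Import numFieldNormedType.Exports.

Local Open Scope classical_set_scope.
Local Open Scope ring_scope.

(* The library norm on 'rV[R]_N is the max norm, hence the explicit
   Euclidean structure. *)
Definition dot (R : realType) (N : nat) (x y : 'rV[R]_N) : R :=
  (x *m y^T) 0 0.

Definition enorm (R : realType) (N : nat) (x : 'rV[R]_N) : R :=
  Num.sqrt (dot x x).

(* R^N as a measurable space with its Borel sigma-algebra; the carrier is
   convertible to 'rV[R]_N. *)
Notation borel_rV R N := (g_sigma_algebraType (@open 'rV[R]_N)).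

Definition expi (R : realType) (x : R) : R[i] :=
  Complex (cos x) (sin x).

Definition Cintegral (d : measure_display) (T : measurableType d)
    (R : realType) (mu : {measure set T -> \bar R}) (D : set T)
    (f : T -> R[i]) : R[i] :=
  Complex (Rintegral mu D (fun x => complex.Re (f x)))
          (Rintegral mu D (fun x => complex.Im (f x))).

(* The degenerate (variance zero) law is allowed; it is listed separately
   because normal_prob m 0 is not the Dirac mass at m. *)
Definition gaussian (d : measure_display) (T : measurableType d)
    (R : realType) (P : probability T R) (Y : T -> R) : Prop :=
  (exists m s : R, 0 < s /\ forall A : set R, measurable A ->
     P (Y @^-1` A) = normal_prob m s A) \/
  (exists m : R, forall A : set R, measurable A ->
     P (Y @^-1` A) = \d_m A).

Definition gaussian_field (d : measure_display) (T : measurableType d)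
    (R : realType) (P : probability T R) (N : nat)
    (X : 'rV[R]_N -> {RV P >-> R}) : Prop :=
  forall (n : nat) (t : 'I_n -> 'rV[R]_N) (a : 'I_n -> R),
    gaussian P (fun w => \sum_(i < n) a i * X (t i) w).

Definition centered (d : measure_display) (T : measurableType d)
    (R : realType) (P : probability T R) (N : nat)
    (X : 'rV[R]_N -> {RV P >-> R}) : Prop :=
  forall t, 'E_P[X t]%E = 0%E.

(* For every h, the fields X(. + h) - X(h) and X(.) - X(0) have the same
   finite-dimensional distributions. *)
Definition stationary_increments (d : measure_display) (T : measurableType d)
    (R : realType) (P : probability T R) (N : nat)
    (X : 'rV[R]_N -> {RV P >-> R}) : Prop :=
  forall (h : 'rV[R]_N) (n : nat) (t : 'I_n -> 'rV[R]_N)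
    (B : set (borel_rV R n)), measurable B ->
    P [set w | B (\row_(i < n) (X (t i + h) w - X h w))] =
    P [set w | B (\row_(i < n) (X (t i) w - X 0 w))].

Definition covariance_function (d : measure_display) (T : measurableType d)
    (R : realType) (P : probability T R) (N : nat)
    (X : 'rV[R]_N -> {RV P >-> R}) (s t : 'rV[R]_N) : R :=
  fine 'E_P[fun w => (X s w * X t w)%R]%E.

Definition punctured_rV (R : realType) (N : nat) : set (borel_rV R N) :=
  ~` [set (0 : 'rV[R]_N)].
Arguments punctured_rV : clear implicits.

(* A measure on R^N \ {0} is encoded as a Borel measure on R^N which does
   not charge the origin. *)
Definition spectral_measure (R : realType) (N : nat)
    (F : {measure set (borel_rV R N) -> \bar R}) : Prop :=
  [/\ F [set (0 : 'rV[R]_N)] = 0%E,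
      (forall A : set (borel_rV R N), measurable A ->
         F [set l : 'rV[R]_N | A (- l)] = F A) &
      (\int[F]_(l in punctured_rV R N)
         (enorm l ^+ 2 / (1 + enorm l ^+ 2))%:E < +oo)%E].

Definition spectral_representation (d : measure_display)
    (T : measurableType d) (R : realType) (P : probability T R) (N : nat)
    (X : 'rV[R]_N -> {RV P >-> R})
    (F : {measure set (borel_rV R N) -> \bar R}) : Prop :=
  forall s t : 'rV[R]_N,
    Complex (covariance_function X s t) 0 =
    Cintegral F (punctured_rV R N)
      (fun l => (expi (dot s l) - 1) * (expi (- dot t l) - 1)).

Definition is_variogram (d : measure_display) (T : measurableType d)
    (R : realType) (P : probability T R) (N : nat)
    (X : 'rV[R]_N -> {RV P >-> R}) (v : 'rV[R]_N -> R) : Prop :=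
  forall t h : 'rV[R]_N,
    'E_P[fun w => ((X (t + h) w - X t w) ^+ 2)%R]%E = (v h)%:E.

Definition partial (R : realType) (N : nat) (i : 'I_N)
    (f : 'rV[R]_N -> R) : 'rV[R]_N -> R :=
  'D_(delta_mx 0 i) f.

Definition continuous_second_partials (R : realType) (N : nat)
    (f : 'rV[R]_N -> R) : Prop :=
  forall i j : 'I_N,
    [/\ forall x : 'rV[R]_N, derivable f x (delta_mx 0 j),
        forall x : 'rV[R]_N, derivable (partial j f) x (delta_mx 0 i) &
        continuous (partial i (partial j f))].

(* The expectation is taken in \bar R, so convergence to 0 includes its
   finiteness for all small h. *)
Definition ms_differentiable (d : measure_display) (T : measurableType d)
    (R : realType) (P : probability T R) (N : nat)
    (X : 'rV[R]_N -> {RV P >-> R}) (t : 'rV[R]_N) : Prop :=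
  exists G : {RV P >-> borel_rV R N},
    forall u : 'rV[R]_N, enorm u = 1 ->
      'E_P[fun w =>
         (((X (t + h *: u) w - X t w - h * dot u (G w)) / h) ^+ 2)%R]%E
        @[h --> 0^'+] --> 0%E.

(* Main.v *)
(* The variogram determines the second moment of every contrast, i.e. of every
   linear combination of values of X with weights of sum zero. The inner product
   of two difference quotients in a coordinate direction e_i, with steps a and b,
   is half a mixed second difference of v divided by its steps, hence by two
   applications of the mean value theorem half a value of the continuous function
   d_i^2 v near 0. So the quotients (X(t + a e_i) - X(t)) / a are Cauchy in L^2 as
   a -> 0, and their limit Y_i also approximates the increments starting at any s
   near t, uniformly in s. Going from t to t + hu along the coordinate axes then
   shows that (Y_1, ..., Y_N) is the mean square gradient. *)
From HB Require Import structures.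
Require Import Defs.
From mathcomp Require Import all_boot all_order all_algebra.
From mathcomp Require Import complex.
From mathcomp Require Import all_classical all_reals all_analysis.
From mathcomp Require Import measurable_realfun ring lra.

Import Order.TTheory GRing.Theory Num.Theory.
Import numFieldNormedType.Exports.

Local Open Scope classical_set_scope.
Local Open Scope ring_scope.

Set Implicit Arguments.
Unset Strict Implicit.
Unset Printing Implicit Defensive.

(** * Mixed second differences *)

(** The step may have either sign; [|c - x| <= |a|] replaces membership in an interval whose
    orientation depends on [a]. *)
Lemma mean_value_signed (R : realType) (f df : R -> R) (x a : R)
    (f_df : forall y : R, is_derive y 1 f (df y)) :
  exists2 c, `|c - x| <= `|a| & f (x + a) - f x = a * df c.
Proof.
have f_cont : continuous f.
  by move=> y; apply: differentiable_continuous; apply/derivable1_diffP.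
have [a0|a0] := leP 0 a.
- have xa : x <= x + a by rewrite lerDl.
  have [c] := @MVT_segment R f df _ _ xa (fun y _ => f_df y)
    (continuous_subspaceT f_cont).
  rewrite in_itv /= => /andP[xc cxa] ->; exists c; last by ring.
  rewrite !ger0_norm //; lra.
- have xa : x + a <= x by rewrite gerDl ltW.
  have [c] := @MVT_segment R f df _ _ xa (fun y _ => f_df y)
    (continuous_subspaceT f_cont).
  rewrite in_itv /= => /andP[xc cxa] E; exists c; last by rewrite -opprB E; ring.
  rewrite ler0_norm ?ltr0_norm //; lra.
Qed.

(** With [g y = f (y + b) - f y] the mixed difference is the increment of [g] over the step [a]; the
    mean value theorem applies to [g], then to [df]. *)
Lemma mixed_difference (R : realType) (f df ddf : R -> R) (x a b : R)
    (f_df : forall y : R, is_derive y 1 f (df y))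
    (df_ddf : forall y : R, is_derive y 1 df (ddf y)) :
  exists2 c, `|c - x| <= `|a| + `|b| &
    f (x + a + b) - f (x + a) - f (x + b) + f x = a * b * ddf c.
Proof.
pose g y := f (y + b) - f y.
have g_dg (y : R) : is_derive y 1 g (df (y + b) - df y).
  have fb : is_derive y 1 (fun z => f (z + b)) (df (y + b)).
    rewrite -[df _]mulr1; apply: (@is_derive1_comp _ f (fun z => z + b)).
    rewrite -[1 in X in is_derive _ _ _ X]addr0.
    exact: is_deriveD.
  exact: is_deriveB.
have [c1 c1x E1] := mean_value_signed x a g_dg.
have [c cc1 E2] := mean_value_signed c1 b df_ddf.
exists c.
  rewrite (_ : c - x = (c1 - x) + (c - c1)); last by ring.
  by rewrite (le_trans (ler_normD _ _)) // lerD.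
transitivity (g (x + a) - g x); first by rewrite /g; ring.
by rewrite E1 E2 mulrA.
Qed.

Lemma is_derive_line (R : realType) (V : normedModType R) (f : V -> R)
    (x e : V) (a : R) :
  derivable f (x + a *: e) e ->
  is_derive a 1 (fun b => f (x + b *: e)) ('D_e f (x + a *: e)).
Proof.
have E : (fun h : R => h^-1 *:
    (((fun b => f (x + b *: e)) \o shift a) (h *: 1) - f (x + a *: e))) =
  (fun h => h^-1 *: ((f \o shift (x + a *: e)) (h *: e) - f (x + a *: e))).
  apply/funext => h /=; congr (_ *: (f _ - _)).
  by rewrite scalerDl addrCA [_ *: 1]mulr1.
by move=> df; apply: DeriveDef; rewrite /derivable /derive E.
Qed.

(** On the line through [x] in direction [e] the mixed difference is [a * b] times a value of the
    second partial derivative near 0, which continuity brings close to its value at 0. *)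
Lemma mixed_difference_near0 (R : realType) (N : nat) (i : 'I_N)
    (v : 'rV[R]_N -> R) (eps : R) :
  let e : 'rV[R]_N := delta_mx 0 i in
  continuous_second_partials v -> 0 < eps ->
  exists2 delta, 0 < delta & forall (x : 'rV[R]_N) (a b : R),
    `|x| < delta -> `|a| < delta -> `|b| < delta ->
    `|v (x + (a + b) *: e) - v (x + a *: e) - v (x + b *: e) + v x
      - a * b * partial i (partial i v) 0| <= eps * `|a * b|.
Proof.
move=> e /(_ i i)[dv ddv ddv_cont] eps0.
have /cvgr_dist_le /(_ _ eps0) := ddv_cont 0.
move=> /nbhs_norm0P[d d0 dP].
(* The intermediate point is [x + c *: e] with [|c| <= |a| + |b|], so its norm stays below
   [D + 2 * D * |e| = d]. *)
exists (d / (1 + 2 * `|e|)).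
  by rewrite divr_gt0 // ltr_wpDr // mulr_ge0.
set D := d / _ => x a b xd ad bd.
have [c] := @mixed_difference R (fun r => v (x + r *: e))
   (fun r => partial i v (x + r *: e))
   (fun r => partial i (partial i v) (x + r *: e)) 0 a b
   (fun y => is_derive_line (dv _)) (fun y => is_derive_line (ddv _)).
rewrite !add0r subr0 scale0r addr0 => cab ->.
rewrite -mulrBr normrM mulrC ler_wpM2r // distrC.
apply: dP => /=.
have -> : d = D + 2 * D * `|e|.
  rewrite /D; field.
  have : 0 <= `|e| by []. 
  lra.
rewrite (le_lt_trans (ler_normD _ _)) // ltr_leD // normrZ ler_wpM2r //.
lra.
Qed.

(** * Completeness of L^2 *)

Section L2.
Context {d : measure_display} {T : measurableType d} {R : realType}.
Variable P : probability T R.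
Implicit Types Y Z : T -> R.

Lemma measurable_fun_sqr Y :
  measurable_fun setT Y -> measurable_fun setT (fun w => Y w ^+ 2).
Proof. exact: measurable_funX. Qed.

Lemma ge0_expectationD Y Z :
  measurable_fun setT Y -> measurable_fun setT Z ->
  (forall w, 0 <= Y w) -> (forall w, 0 <= Z w) ->
  ('E_P[fun w => (Y w + Z w)%R] = 'E_P[Y] + 'E_P[Z])%E.
Proof.
move=> mY mZ Y0 Z0; rewrite unlock; under eq_integral do rewrite EFinD.
rewrite ge0_integralD //; try by move=> *; rewrite lee_fin.
- exact/measurable_EFinP.
- exact/measurable_EFinP.
Qed.

Lemma ge0_expectationZl (k : R) Y :
  measurable_fun setT Y -> (forall w, 0 <= Y w) -> 0 <= k ->
  ('E_P[fun w => (k * Y w)%R] = k%:E * 'E_P[Y])%E.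
Proof.
move=> mY Y0 k0; rewrite unlock; under eq_integral do rewrite EFinM.
rewrite ge0_integralZl_EFin //; try by move=> *; rewrite lee_fin.
exact/measurable_EFinP.
Qed.

(** Stands in for the triangle inequality of L^2, also when second moments are infinite; pointwise
    it is [(Y - Z)^2 >= 0]. *)
Lemma expectation_sqrD_le Y Z :
  measurable_fun setT Y -> measurable_fun setT Z ->
  ('E_P[fun w => ((Y w + Z w) ^+ 2)%R] <=
   2%:E * 'E_P[fun w => (Y w ^+ 2)%R] + 2%:E * 'E_P[fun w => (Z w ^+ 2)%R])%E.
Proof.
move=> mY mZ.
have mY2 := measurable_fun_sqr mY; have mZ2 := measurable_fun_sqr mZ.
rewrite -!ge0_expectationZl //; try by move=> w; exact: sqr_ge0.
have sqr2 (U : T -> R) w : 0 <= 2 * U w ^+ 2 by rewrite mulr_ge0 ?sqr_ge0.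
have m2 (U : T -> R) : measurable_fun setT (fun w => U w ^+ 2) ->
  measurable_fun setT (fun w => 2 * U w ^+ 2) by exact: measurable_funM.
rewrite -ge0_expectationD //; [|exact: m2|exact: m2].
apply: expectation_le.
- exact/measurable_fun_sqr/measurable_funD.
- by apply: measurable_funD; exact: m2.
- by move=> w; exact: sqr_ge0.
- by move=> w; rewrite addr_ge0.
- by apply: aeW => w; have := sqr_ge0 (Y w - Z w); nra.
Qed.

Lemma expectation_norm_le (s : R) Y :
  measurable_fun setT Y -> 0 < s ->
  ('E_P[fun w => (Y w ^+ 2)%R] <= (s ^+ 2)%:E)%E ->
  ('E_P[fun w => `|Y w|%R] <= s%:E)%E.
Proof.
move=> mY s0 EY.
have mY2 := measurable_fun_sqr mY.
have s20 : 0 <= (2 * s)^-1 by rewrite invr_ge0 mulr_ge0 // ltW.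
have m1 : measurable_fun setT (fun w => (2 * s)^-1 * Y w ^+ 2).
  exact: measurable_funM.
have p1 w : 0 <= (2 * s)^-1 * Y w ^+ 2 by rewrite mulr_ge0 ?sqr_ge0.
apply: (@le_trans _ _ 'E_P[fun w => (s / 2 + (2 * s)^-1 * Y w ^+ 2)%R]%E).
  apply: expectation_le.
  - exact: measurableT_comp.
  - exact: measurable_funD.
  - by [].
  - by move=> w; rewrite addr_ge0 // divr_ge0 // ltW.
  - (* AM-GM: [2 s |Y| <= s^2 + Y^2] *)
    apply: aeW => w; rewrite -(ler_pM2l (_ : 0 < 2 * s)); last by lra.
    rewrite mulrDr [X in _ + X]mulrA divff ?mul1r; last by lra.
    by have := sqr_ge0 (`|Y w| - s); rewrite -[Y w ^+ 2]real_normK ?num_real //; nra.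
rewrite (ge0_expectationD (Y := fun=> s / 2)) //; last first.
  by move=> _; lra.
rewrite [X in (X + _)%E](_ : _ = (s / 2)%:E); last exact: expectation_cst.
rewrite ge0_expectationZl //; last by move=> w; exact: sqr_ge0.
apply: (@le_trans _ _ ((s / 2)%:E + ((2 * s)^-1)%:E * (s ^+ 2)%:E)%E).
  by rewrite leeD2l // lee_pmul // ?expectation_ge0 // => w; exact: sqr_ge0.
rewrite -EFinM -EFinD lee_fin le_eqVlt; apply/orP; left; apply/eqP.
by field; lra.
Qed.

(** The sum [S] of all the distances has expectation at most 1, hence is finite almost everywhere;
    where it is finite, the telescoping series of [u] converges absolutely. *)
Lemma ae_cvg_of_summable_expectation (u : nat -> T -> R) :
  (forall n, measurable_fun setT (u n)) ->
  (forall n, ('E_P[fun w => `|u n.+1 w - u n w|%R] <=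
              (1 / (2 ^ n.+1)%:R)%:E)%E) ->
  \forall w \ae P, cvgn (u ^~ w).
Proof.
move=> mu Eu.
pose z n w := `|u n.+1 w - u n w|.
have mz n : measurable_fun setT (fun w => (z n w)%:E).
  by apply/measurable_EFinP/measurableT_comp => //; exact: measurable_funB.
have z0 n w : (0 <= (z n w)%:E)%E by rewrite lee_fin normr_ge0.
pose S w := (\sum_(0 <= n <oo) (z n w)%:E)%E.
have intS : P.-integrable setT S.
  apply/integrableP; split; first exact: ge0_emeasurable_sum.
  under eq_integral do rewrite gee0_abs ?nneseries_ge0//.
  rewrite integral_nneseries //.
  apply: (@le_lt_trans _ _ 1%:E); last by rewrite ltry.
  apply: le_trans (epsilon_trick0 xpredT ler01).
  apply: lee_nneseries => n *; first exact: integral_ge0.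
  by have := Eu n; rewrite unlock.
have := integrable_ae measurableT intS; apply: filterS => w /(_ I) Sfin.
have cs : cvgn (series (fun n => u n.+1 w - u n w)).
  apply: normed_cvg; apply: nondecreasing_is_cvgn.
    by apply: nondecreasing_series => *; exact: normr_ge0.
  exists (fine (S w)) => _ [n _ <-].
  rewrite -lee_fin fineK // /series /= -sumEFin.
  exact: nneseries_lim_ge.
have -> : u ^~ w = (fun n => u 0%N w + series (fun n => u n.+1 w - u n w) n).
  by apply/funext => n; rewrite /series /= telescope_sumr // addrC subrK.
exact: is_cvgD (is_cvg_cst _) cs.
Qed.

Lemma limn_einf_le (u : nat -> \bar R) (c : \bar R) :
  (\forall n \near \oo, (u n <= c)%E) -> (limn_einf u <= c)%E.
Proof.
move=> uc; rewrite limn_einf_lim; apply: lime_le; first exact: is_cvg_einfs.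
by apply: filterS uc => n; apply: le_trans; apply: ereal_inf_lbound; exists n => /=.
Qed.

(** Fatou's lemma for [(Z - u n)^2], whose lower limit is almost everywhere [(Z - Y)^2]. *)
Lemma expectation_sqr_lim_le (u : nat -> T -> R) Y Z (c : \bar R) :
  (forall n, measurable_fun setT (u n)) ->
  measurable_fun setT Y -> measurable_fun setT Z ->
  (\forall w \ae P, u n w @[n --> \oo] --> Y w) ->
  (\forall n \near \oo, ('E_P[fun w => ((Z w - u n w) ^+ 2)%R] <= c)%E) ->
  ('E_P[fun w => ((Z w - Y w) ^+ 2)%R] <= c)%E.
Proof.
move=> mu mY mZ uY Euc.
pose f n w := ((Z w - u n w) ^+ 2)%:E.
have mf n : measurable_fun setT (f n).
  exact/measurable_EFinP/measurable_fun_sqr/measurable_funB.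
have f0 n w : (0 <= f n w)%E by rewrite lee_fin sqr_ge0.
have mlim : measurable_fun setT (fun w => limn_einf (f ^~ w)).
  have -> : (fun w => limn_einf (f ^~ w)) =
      (fun w => - limn_esup (fun n => - f n w))%E.
    apply/funext => w; rewrite -(limn_einfN (fun n => - f n w)%E).
    by congr limn_einf; apply/funext => n /=; rewrite opprK.
  apply: measurableT_comp => //; apply: measurable_fun_limn_esup => n.
  exact: measurableT_comp.
rewrite unlock (@ge0_ae_eq_integral _ _ _ _ _ _ (fun w => limn_einf (f ^~ w))) //.
- apply: le_trans (fatou _ _ mf _) _ => //; apply: limn_einf_le.
  by apply: filterS Euc => n; rewrite unlock.
- exact/measurable_EFinP/measurable_fun_sqr/measurable_funB.
- by move=> w _; rewrite lee_fin sqr_ge0.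
- move=> w _; rewrite limn_einf_lim; apply: lime_ge; first exact: is_cvg_einfs.
  by apply: nearW => n; apply: le_ereal_inf_tmp => _ [m _ <-].
- apply: filterS uY => w uYw _; apply/esym.
  apply: (cvg_limn_einf_sup _).1; apply: cvg_EFin; first exact: nearW.
  rewrite expr2; apply: cvgM; apply: cvgB => //; exact: cvg_cst.
Qed.

(** A general filter is used because the difference quotients are indexed by real steps tending to
    0, not by integers. *)
Lemma L2_complete (I : Type) (F : set_system I) (FF : ProperFilter F)
    (D : I -> T -> R) :
  (forall i, measurable_fun setT (D i)) ->
  (forall eps : R, 0 < eps -> exists2 A, F A & forall i j, A i -> A j ->
     ('E_P[fun w => ((D i w - D j w) ^+ 2)%R] <= eps%:E)%E) ->
  exists2 Y : T -> R, measurable_fun setT Y & forall eps : R, 0 < eps ->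
     \forall i \near F, ('E_P[fun w => ((D i w - Y w) ^+ 2)%R] <= eps%:E)%E.
Proof.
move=> mD cD.
(* A subsequence with summable L^1 distances converges almost surely, and
   Fatou's lemma identifies its pointwise limit as the L^2 limit. *)
pose s n : R := 1 / (2 ^ n.+1)%:R.
have s0 n : 0 < s n by rewrite divr_gt0 // ltr0n expn_gt0.
have /choice[A FA] n : exists A, F A /\ forall i j, A i -> A j ->
    ('E_P[fun w => ((D i w - D j w) ^+ 2)%R] <= (s n ^+ 2)%:E)%E.
  by have [A ? ?] := cD _ (exprn_gt0 2 (s0 n)); exists A.
(* The sets [A k] need not be nested, so [i n] is taken in the intersection of the first [n.+1] of
   them. *)
have /choice[i Ai] n : exists i, forall k : 'I_n.+1, A k i.
  apply: (@filter_ex _ F); apply: filter_forall => k; exact: (FA k).1.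
have {}Ai n k : (k <= n)%N -> A k (i n).
  by rewrite -ltnS => kn; exact: (Ai n (Ordinal kn)).
pose u n := D (i n).
have mu n : measurable_fun setT (u n) by exact: mD.
have cvgu : \forall w \ae P, cvgn (u ^~ w).
  apply: ae_cvg_of_summable_expectation => // n.
  apply: expectation_norm_le => //; first exact: measurable_funB.
  by apply: (FA n).2; exact: Ai.
(* The upper limit is measurable on the whole space; [fine] sends infinite values to 0, which can
   occur only on a null set. *)
pose Y w := fine (limn_esup (fun n => (u n w)%:E)).
have mY : measurable_fun setT Y.
  apply: (measurableT_comp (fine_measurable _)) => //.
  by apply: measurable_fun_limn_esup => n; exact/measurable_EFinP.
have uY : \forall w \ae P, u n w @[n --> \oo] --> Y w.
  apply: filterS cvgu => w cw.
  have uE : (u n w)%:E @[n --> \oo] --> (limn (u ^~ w))%:E.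
    by apply: cvg_EFin => //; exact: nearW.
  by rewrite /Y (cvg_limn_einf_sup uE).2.
exists Y => // eps eps0.
have [m sm] : exists m, s m ^+ 2 <= eps.
  have [m _ /(_ _ (leqnn m)) /= sm] := near_infty_natSinv_expn_lt (PosNum eps0).
  exists m; apply: le_trans (ltW sm); rewrite /s !div1r natrX.
  rewrite -exprVn -exprM -exprVn ler_wiXn2l ?invr_ge0 ?invf_le1 ?ler1n //.
  exact: leq_trans (leqnSn m) (leq_pmulr _ _).
(* For [j] in [A m] the distance to [u n] is controlled for every [n >= m], since [i n] is then in
   [A m] too. *)
apply: filterS (FA m).1 => j Aj; apply: (expectation_sqr_lim_le mu) => //.
exists m => // n /= mn; apply: le_trans ((FA m).2 _ _ Aj (Ai _ _ mn)) _.
by rewrite lee_fin.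
Qed.
End L2.

(** * Borel measurability of random vectors *)

(** These open cubes form a base of the topology indexed by a countable type. *)
Definition rational_box (R : realType) (N : nat) (qk : 'rV[rat]_N * nat) :
    set 'rV[R]_N :=
  [set y | forall i, `|y 0 i - ratr (qk.1 0 i)| < 1 / (2 ^ qk.2)%:R].

(** If the ball of radius [e] around [x] lies in [U], so does any cube containing [x] whose half
    side is less than [e / 2]. *)
Lemma open_bigcup_rational_box (R : realType) (N : nat) (U : set 'rV[R]_N) :
  open U ->
  U = \bigcup_(qk in [set qk | rational_box qk `<=` U]) rational_box qk.
Proof.
move=> oU; apply/seteqP; split=> [x Ux|x [qk qkU]]; last exact: qkU.
have /nbhs_ballP[e /= e0 eU] : nbhs x U by exact: open_nbhs_nbhs.
have e20 : 0 < e / 2 by rewrite divr_gt0.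
have [k _ /(_ _ (leqnn k)) /= ke] := near_infty_natSinv_expn_lt (PosNum e20).
pose r : R := 1 / (2 ^ k)%:R.
have r0 : 0 < r by rewrite divr_gt0 // ltr0n expn_gt0.
have rE : r < e / 2 by rewrite /r natrX.
have /choice[q xq] i : exists q : rat, `|x 0 i - ratr q| < r.
  have [|q] := @rat_in_itvoo R (x 0 i - r) (x 0 i + r); first by lra.
  by rewrite in_itv /= => qi; exists q; rewrite ltr_distlC.
exists (\row_i q i, k); last by move=> i /=; rewrite mxE; exact: xq.
move=> y /= yq; apply: eU; split=> // i0 j; rewrite ord1 /ball /=.
have := yq j; rewrite mxE => yqj.
rewrite (_ : _ - _ = (x 0 j - ratr (q j)) - (y 0 j - ratr (q j))); last by ring.
rewrite (le_lt_trans (ler_normB _ _)) // (splitr e).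
by rewrite ltrD // (lt_trans _ rE) //; exact: xq.
Qed.

(** An open set is a countable union of rational boxes, and the preimage of a box is a finite
    intersection of conditions on single coordinates. *)
Lemma measurable_fun_row (d : measure_display) (T : measurableType d)
    (R : realType) (N : nat) (Y : 'I_N -> T -> R) :
  (forall i, measurable_fun setT (Y i)) ->
  measurable_fun setT (fun w => \row_i Y i w : borel_rV R N).
Proof.
move=> mY; apply: measurability; first by [].
move=> _ [U oU <-]; rewrite setTI (open_bigcup_rational_box oU) preimage_bigcup.
rewrite bigcup_mkcond; apply: countable_bigcupT_measurable => // qk.
case: ifPn => // _.
rewrite (_ : _ @^-1` _ = \bigcap_(i in [set: 'I_N])
   ((fun w => `|Y i w - ratr (qk.1 0 i)|) @^-1` `]-oo, 1 / (2 ^ qk.2)%:R[)).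
  apply: fin_bigcap_measurable => // i _; rewrite -[X in measurable X]setTI.
  suff mYi : measurable_fun setT (fun w => `|Y i w - ratr (qk.1 0 i)|).
    by apply: mYi.
  by apply: (measurableT_comp (@normr_measurable _ _)); exact: measurable_funB.
apply/seteqP; split=> w Yw i.
- by move=> _; have := Yw i; rewrite mxE /= in_itv.
- by have := Yw i I; rewrite /= in_itv mxE.
Qed.

(** * Increments and the variogram *)

Section Variogram.
Context {d : measure_display} {T : measurableType d} {R : realType}.
Variable P : probability T R.

(** Integrability is kept with the value so that sums with weights of either sign can be integrated
    termwise. *)
Definition has_mean (Y : T -> R) (m : R) : Prop :=
  Y \in Lfun P 1 /\ ('E_P[Y] = m%:E)%E.

Lemma has_mean_ge0 (Y : T -> R) (m : R) :
  measurable_fun setT Y -> (forall w, 0 <= Y w) -> ('E_P[Y] = m%:E)%E ->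
  has_mean Y m.
Proof.
move=> mY Y0 EY; split=> //; apply/Lfun1_integrable/integrableP; split.
  exact/measurable_EFinP.
under eq_integral do rewrite /= ger0_norm //.
by move: EY; rewrite unlock => ->; rewrite ltry.
Qed.

Lemma has_mean_sum (I : Type) (r : seq I) (c m : I -> R) (Y : I -> T -> R) :
  (forall i, has_mean (Y i) (m i)) ->
  has_mean (fun w => \sum_(i <- r) c i * Y i w) (\sum_(i <- r) c i * m i).
Proof.
move=> Ym; elim: r => [|i r [IHL IHE]].
  rewrite big_nil (_ : (fun _ => _) = cst 0); last first.
    by apply/funext => w; rewrite big_nil.
  by split; [exact: rpred0 | exact: expectation_cst].
have [YL YE] := Ym i.
have cYL : (c i \o* Y i) \in Lfun P 1.
  rewrite (_ : _ \o* _ = c i *: Y i); first exact: rpredZ.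
  by apply/funext => w /=; rewrite mulrC.
rewrite big_cons (_ : (fun _ => _) =
  (c i \o* Y i) \+ (fun w => \sum_(j <- r) c j * Y j w)); last first.
  by apply/funext => w /=; rewrite big_cons mulrC.
split; first exact: rpredD.
by rewrite expectationD // expectationZl // YE IHE.
Qed.

(** When [(x i - x j)^2] is expanded, the pure squares are killed by the zero sum of the weights and
    only the products [x i * x j] remain. *)
Lemma sqr_sum_contrast (I : Type) (r : seq I) (c x : I -> R) :
  \sum_(i <- r) c i = 0 ->
  (\sum_(i <- r) c i * x i) ^+ 2 =
  \sum_(i <- r) - (c i / 2) * \sum_(j <- r) c j * (x i - x j) ^+ 2.
Proof.
move=> c0; set S := \sum_(i <- r) c i * x i.
pose Q := \sum_(i <- r) c i * x i ^+ 2.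
have E i : - (c i / 2) * \sum_(j <- r) c j * (x i - x j) ^+ 2 =
    S * (c i * x i) - Q / 2 * c i.
  have -> : \sum_(j <- r) c j * (x i - x j) ^+ 2 =
      x i ^+ 2 * (\sum_(j <- r) c j) + Q - 2 * x i * S.
    rewrite /Q /S !mulr_sumr -sumrN -!big_split /=.
    by apply: eq_bigr => j _; ring.
  by rewrite c0; field.
under eq_bigr do rewrite E.
by rewrite sumrB -!mulr_sumr c0 mulr0 subr0 expr2.
Qed.

Variable N : nat.
Variables (X : 'rV[R]_N -> {RV P >-> R}) (v : 'rV[R]_N -> R).
Hypothesis Xv : is_variogram X v.

Lemma measurable_rv t : measurable_fun setT (X t).
Proof. exact: measurable_funPT. Qed.

Lemma variogram0 : v 0 = 0.
Proof.
have := Xv 0 0; rewrite addr0 (_ : (fun _ => _) = cst 0).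
  by rewrite expectation_cst => -[].
by apply/funext => w; rewrite subrr expr0n.
Qed.

Lemma variogramN h : v (- h) = v h.
Proof.
have := Xv h (- h); rewrite subrr => E1.
have := Xv 0 h; rewrite add0r => E2.
suff: ((v (- h))%:E = (v h)%:E)%E by case.
rewrite -E1 -E2; congr 'E_P[_]%E.
by apply/funext => w; rewrite -[LHS]sqrrN opprB.
Qed.

(** A contrast is a list of pairs of a weight and a point. Its square is a linear combination of
    squared increments, whose means are values of [v]. *)
Lemma expectation_sqr_contrast (r : seq (R * 'rV[R]_N)) :
  \sum_(p <- r) p.1 = 0 ->
  ('E_P[fun w => ((\sum_(p <- r) p.1 * X p.2 w) ^+ 2)%R] =
   (\sum_(p <- r) - (p.1 / 2) * \sum_(q <- r) q.1 * v (p.2 - q.2))%:E)%E.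
Proof.
move=> r0.
rewrite (_ : (fun _ => _) = fun w => \sum_(p <- r) - (p.1 / 2) *
    \sum_(q <- r) q.1 * (X p.2 w - X q.2 w) ^+ 2); last first.
  apply/funext => w.
  exact: (@sqr_sum_contrast _ r (fun p => p.1) (fun p => X p.2 w)).
apply: (has_mean_sum _ _ _).2 => p; apply: has_mean_sum => q.
apply: has_mean_ge0.
- apply: measurable_fun_sqr; apply: measurable_funB; exact: measurable_rv.
- by move=> w; exact: sqr_ge0.
- by rewrite -(Xv q.2) subrKC.
Qed.

(** The difference of the two quotients is a contrast at three points with weights [1/a], [-1/b] and
    [1/b - 1/a]. *)
Lemma expectation_sqr_difference_quotients (t e : 'rV[R]_N) (a b : R) :
  a != 0 -> b != 0 ->
  ('E_P[fun w => (((X (t + a *: e) w - X t w) / a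
                  - (X (t + b *: e) w - X t w) / b) ^+ 2)%R] =
   (v (a *: e) * (a ^- 2 - (a * b)^-1) + v (b *: e) * (b ^- 2 - (a * b)^-1)
    + v ((a - b) *: e) / (a * b))%:E)%E.
Proof.
move=> a0 b0.
pose r := [:: (a^-1, t + a *: e); (- b^-1, t + b *: e); (b^-1 - a^-1, t)].
have r0 : \sum_(p <- r) p.1 = 0 by rewrite !big_cons big_nil /=; ring.
rewrite (_ : (fun _ => _) = fun w => (\sum_(p <- r) p.1 * X p.2 w) ^+ 2);
  last first.
  by apply/funext => w; rewrite !big_cons big_nil /=; ring.
rewrite (expectation_sqr_contrast r0); congr (_%:E).
have dtt y z : t + y - (t + z) = y - z by rewrite opprD addrACA subrr add0r.
have dt y : t + y - t = y by rewrite addrC addKr.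
have td y : t - (t + y) = - y by rewrite opprD addNKr.
rewrite !big_cons !big_nil /= !dtt !dt !td !subrr variogram0 !variogramN.
rewrite -(opprB (a *: e)) variogramN -scalerBl.
by field; rewrite a0 b0.
Qed.

(** A contrast at four points. The value is the mixed difference of [v] with steps [y] and [-y] at
    [s - t], minus the one at 0. *)
Lemma expectation_sqr_increment_difference (s t y : 'rV[R]_N) :
  ('E_P[fun w => ((X (s + y) w - X s w - (X (t + y) w - X t w)) ^+ 2)%R] =
   (2 * v y + 2 * v (s - t) - v (s - t + y) - v (s - t - y))%:E)%E.
Proof.
pose r := [:: (1, s + y); (- 1, s); (- 1, t + y); (1, t)] : seq (R * 'rV[R]_N).
have r0 : \sum_(p <- r) p.1 = 0 by rewrite !big_cons big_nil /=; ring.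
rewrite (_ : (fun _ => _) = fun w => (\sum_(p <- r) p.1 * X p.2 w) ^+ 2);
  last first.
  by apply/funext => w; rewrite !big_cons big_nil /=; ring.
rewrite (expectation_sqr_contrast r0); congr (_%:E).
have sy : s + y - s = y by rewrite addrC addKr.
have ty : t + y - t = y by rewrite addrC addKr.
have ys : s - (s + y) = - y by rewrite opprD addNKr.
have yt : t - (t + y) = - y by rewrite opprD addNKr.
have st1 : s + y - (t + y) = s - t by rewrite opprD addrACA subrr addr0.
have st2 : s + y - t = s - t + y by rewrite addrAC.
have st3 : s - (t + y) = s - t - y by rewrite opprD addrA.
have ts1 : t + y - (s + y) = - (s - t) by rewrite -opprB st1.
have ts2 : t + y - s = - (s - t - y) by rewrite -st3 opprB.
have ts3 : t - (s + y) = - (s - t + y) by rewrite -st2 opprB.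
rewrite !big_cons !big_nil /= sy ty ys yt st1 st2 st3 ts1 ts2 ts3.
rewrite -(opprB s t) !subrr variogram0 !variogramN.
by field.
Qed.
End Variogram.

(** * Partial mean square derivatives *)

Section PartialDerivatives.
Context {d : measure_display} {T : measurableType d} {R : realType}.
Variables (P : probability T R) (N : nat).
Variables (X : 'rV[R]_N -> {RV P >-> R}) (v : 'rV[R]_N -> R).
Hypotheses (Xv : is_variogram X v) (v_C2 : continuous_second_partials v).

Let e (i : 'I_N) : 'rV[R]_N := delta_mx 0 i.

Lemma difference_quotients_cauchy (t : 'rV[R]_N) (i : 'I_N) (eps : R) :
  0 < eps -> exists2 delta, 0 < delta & forall a b : R,
    a != 0 -> b != 0 -> `|a| < delta -> `|b| < delta ->
    ('E_P[fun w => (((X (t + a *: e i) w - X t w) / a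
                    - (X (t + b *: e i) w - X t w) / b) ^+ 2)%R]
     <= eps%:E)%E.
Proof.
move=> eps0; have eps20 : 0 < eps / 2 by rewrite divr_gt0.
have [delta delta0 vP] := @mixed_difference_near0 R N i v (eps / 2) v_C2 eps20.
exists delta => // a b a0 b0 ad bd.
rewrite (expectation_sqr_difference_quotients Xv) // lee_fin.
set c := partial i (partial i v) 0 in vP.
have n0 : `|0 : 'rV[R]_N| < delta by rewrite normr0.
(* At 0 with steps [y] and [-y] the mixed difference is [-2 v (y e)], because [v] is even and
   vanishes at 0. *)
have diag y : y != 0 -> `|y| < delta -> v (y *: e i) / y ^+ 2 <= c / 2 + eps / 4.
  move=> y0 yd; have := vP 0 y (- y) n0 yd; rewrite normrN => /(_ yd).
  rewrite subrr scale0r !add0r scaleNr (variogramN Xv) (variogram0 Xv).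
  rewrite mulrN normrN -expr2 [`|y ^+ 2|]ger0_norm ?sqr_ge0 // ler_norml.
  move=> /andP[yl _].
  rewrite ler_pdivrMr ?exprn_even_gt0 //; lra.
have cross : (v ((a - b) *: e i) - v (a *: e i) - v (b *: e i)) / (a * b)
    <= - c + eps / 2.
  have := vP 0 a (- b) n0 ad; rewrite normrN => /(_ bd).
  rewrite !add0r scaleNr (variogramN Xv) (variogram0 Xv) addr0 mulrN normrN => ab.
  have ab0 : 0 < `|a * b| by rewrite normr_gt0 mulf_neq0.
  set q := _ / _; suff : `|q + c| <= eps / 2 by move/ler_normlW; lra.
  rewrite -(ler_pM2r ab0) -normrM; apply: le_trans ab.
  rewrite /q.
  by rewrite le_eqVlt; apply/orP; left; apply/eqP; congr `|_|; field; rewrite a0 b0.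
(* Two diagonal terms near [c / 2] and a cross term near [-c]: the limits cancel and the errors
   [eps/4], [eps/4], [eps/2] add up to [eps]. *)
have -> : v (a *: e i) * (a ^- 2 - (a * b)^-1) +
    v (b *: e i) * (b ^- 2 - (a * b)^-1) + v ((a - b) *: e i) / (a * b) =
  v (a *: e i) / a ^+ 2 + v (b *: e i) / b ^+ 2 +
  (v ((a - b) *: e i) - v (a *: e i) - v (b *: e i)) / (a * b).
  by field; rewrite a0 b0.
have := diag a a0 ad; have := diag b b0 bd; lra.
Qed.

(** [Y] is the L^2 limit of the difference quotients. Multiplying the estimate by [a^2] lets it
    include [a = 0], so that zero coordinates of a direction need no separate treatment later. *)
Lemma partial_ms_derivative (t : 'rV[R]_N) (i : 'I_N) :
  exists2 Y : T -> R, measurable_fun setT Y & forall eps : R, 0 < eps ->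
    exists2 delta, 0 < delta & forall a : R, `|a| < delta ->
    ('E_P[fun w => ((X (t + a *: e i) w - X t w - a * Y w) ^+ 2)%R]
     <= (eps * a ^+ 2)%:E)%E.
Proof.
pose D (a : R) w := (X (t + a *: e i) w - X t w) / a.
have mX s := measurable_rv X s.
have mD a : measurable_fun setT (D a).
  by apply: measurable_funM => //; exact: measurable_funB.
have [eps eps0|Y mY DY] := @L2_complete _ _ _ P R ((0 : R)^') _ D mD.
  have [delta delta0 DP] := difference_quotients_cauchy t i eps0.
  exists [set a | a != 0 /\ `|a| < delta].
    by apply: filterI; [exact: (nbhs_dnbhs_neq (0 : R)) | exact: (@dnbhs0_lt R R)].
  by move=> a b [a0 ad] [b0 bd]; exact: DP.
exists Y => // eps /DY /nbhs_ballP [delta /= delta0 DP].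
exists delta => // a ad; have [->|a0] := eqVneq a 0.
  rewrite scale0r addr0 expr0n mulr0 (_ : (fun _ => _) = cst 0).
    by rewrite expectation_cst.
  by apply/funext => w; rewrite mul0r subrr subr0 expr0n.
have aDY : (fun w => (X (t + a *: e i) w - X t w - a * Y w) ^+ 2) =
    (fun w => a ^+ 2 * (D a w - Y w) ^+ 2).
  by apply/funext => w; rewrite /D; field.
rewrite aDY ge0_expectationZl ?sqr_ge0 //; last by move=> w; exact: sqr_ge0.
- by rewrite [eps * _]mulrC [(_ * eps)%:E]EFinM lee_pmul2l ?lte_fin
    ?exprn_even_gt0 //; apply: DP => //; rewrite -ball_normE /= sub0r normrN.
- by apply: measurable_fun_sqr; exact: measurable_funB.
Qed.

(** The mixed differences of [v] at [s - t] and at 0 with steps [a] and [-a] are both within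
    [eps/2 * a^2] of the same multiple of [a^2], which cancels. *)
Lemma expectation_sqr_increment_difference_le (i : 'I_N) (eps : R) :
  0 < eps -> exists2 delta, 0 < delta & forall (s t : 'rV[R]_N) (a : R),
    `|s - t| < delta -> `|a| < delta ->
    ('E_P[fun w => ((X (s + a *: e i) w - X s w
                    - (X (t + a *: e i) w - X t w)) ^+ 2)%R]
     <= (eps * a ^+ 2)%:E)%E.
Proof.
move=> eps0; have eps20 : 0 < eps / 2 by rewrite divr_gt0.
have [delta delta0 vP] := @mixed_difference_near0 R N i v (eps / 2) v_C2 eps20.
exists delta => // s t a std ad.
rewrite (expectation_sqr_increment_difference Xv) lee_fin.
have n0 : `|0 : 'rV[R]_N| < delta by rewrite normr0.
have := vP 0 a (- a) n0 ad; have := vP (s - t) a (- a) std ad.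
rewrite normrN => /(_ ad) + /(_ ad).
rewrite subrr scale0r !add0r !addr0 scaleNr (variogramN Xv) (variogram0 Xv).
rewrite mulrN normrN -expr2 [`|a ^+ 2|]ger0_norm ?sqr_ge0 // !ler_norml.
move=> /andP[_ l1] /andP[l2 _]; lra.
Qed.

(** Needed since the legs of a coordinate path start at points that move with [h]. The increment at
    [s] is compared with the one at [t], each error taking [eps / 4]. *)
Lemma partial_ms_derivative_locally_uniform (t : 'rV[R]_N) (i : 'I_N) :
  exists2 Y : T -> R, measurable_fun setT Y & forall eps : R, 0 < eps ->
    exists2 delta, 0 < delta & forall (s : 'rV[R]_N) (a : R),
    `|s - t| < delta -> `|a| < delta ->
    ('E_P[fun w => ((X (s + a *: e i) w - X s w - a * Y w) ^+ 2)%R]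
     <= (eps * a ^+ 2)%:E)%E.
Proof.
have [Y mY tY] := partial_ms_derivative t i.
exists Y => // eps eps0; have eps40 : 0 < eps / 4 by rewrite divr_gt0.
have [d1 d10 H1] := tY _ eps40.
have [d2 d20 H2] := expectation_sqr_increment_difference_le i eps40.
exists (Num.min d1 d2); first by rewrite lt_min d10.
move=> s a; rewrite !lt_min => /andP[_ st2] /andP[a1 a2].
have mX r := measurable_rv X r.
rewrite (_ : (fun _ => _) = fun w =>
  ((X (s + a *: e i) w - X s w - (X (t + a *: e i) w - X t w)) +
   (X (t + a *: e i) w - X t w - a * Y w)) ^+ 2); last first.
  by apply/funext => w; ring.
apply: le_trans (expectation_sqrD_le _ _ _) _.
- by apply: measurable_funB; exact: measurable_funB.
- by apply: measurable_funB; [exact: measurable_funB|exact: measurable_funM].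
- have -> : ((eps * a ^+ 2)%:E = 2%:E * (eps / 4 * a ^+ 2)%:E +
                                 2%:E * (eps / 4 * a ^+ 2)%:E)%E.
    by rewrite -!EFinM -EFinD; congr _%:E; field.
  by rewrite leeD // lee_pmul2l //; [exact: H2|exact: H1].
Qed.
End PartialDerivatives.

(** * Differentiability *)

(** Convergence to 0 in L^2 as [h] decreases to 0; the real bound [eps] also forces finite second
    moments for small [h]. *)
Definition ms_null (d : measure_display) (T : measurableType d) (R : realType)
    (P : probability T R) (f : R -> T -> R) : Prop :=
  (forall h, measurable_fun setT (f h)) /\
  forall eps : R, 0 < eps -> \forall h \near 0^'+,
    ('E_P[fun w => (f h w ^+ 2)%R] <= eps%:E)%E.

Section MsNull.
Context {d : measure_display} {T : measurableType d} {R : realType}.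
Variable P : probability T R.

Lemma ms_null_cvg (f : R -> T -> R) : ms_null P f ->
  ('E_P[fun w => (f h w ^+ 2)%R])%E @[h --> 0^'+] --> 0%E.
Proof.
move=> [_ f0]; apply/fine_cvgP.
have f_ge0 h : (0 <= 'E_P[fun w => (f h w ^+ 2)%R])%E.
  by apply: expectation_ge0 => w; exact: sqr_ge0.
have f_fin h eps : ('E_P[fun w => (f h w ^+ 2)%R] <= eps%:E)%E ->
    ('E_P[fun w => (f h w ^+ 2)%R] \is a fin_num)%E.
  by move=> fh; rewrite ge0_fin_numE // (le_lt_trans fh) // ltry.
split; first by apply: filterS (f0 1 ltr01) => h; exact: f_fin.
apply/cvgr0Pnorm_le => eps /f0; apply: filterS => h fh.
by rewrite ger0_norm ?fine_ge0 // -lee_fin fineK // (f_fin _ _ fh).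
Qed.

Lemma ms_null_sum (I : Type) (r : seq I) (f : I -> R -> T -> R) :
  (forall i, ms_null P (f i)) ->
  ms_null P (fun h w => \sum_(i <- r) f i h w).
Proof.
move=> fN; split=> [h|].
  by apply: measurable_sum => i; exact: (fN i).1.
elim: r => [|i r IH] eps eps0.
  apply: nearW => h; rewrite (_ : (fun _ => _) = cst 0).
    by rewrite expectation_cst lee_fin ltW.
  by apply/funext => w; rewrite big_nil expr0n.
have eps40 : 0 < eps / 4 by rewrite divr_gt0.
apply: filterS2 ((fN i).2 _ eps40) (IH _ eps40) => h fih frh.
rewrite (_ : (fun _ => _) =
  fun w => (f i h w + \sum_(j <- r) f j h w) ^+ 2); last first.
  by apply/funext => w; rewrite big_cons.
apply: le_trans (expectation_sqrD_le _ _ _) _.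
- exact: (fN i).1.
- by apply: measurable_sum => j; exact: (fN j).1.
- have -> : (eps%:E = 2%:E * (eps / 4)%:E + 2%:E * (eps / 4)%:E)%E.
    by rewrite -!EFinM -EFinD; congr _%:E; field.
  by rewrite leeD // lee_pmul2l.
Qed.
End MsNull.

Theorem theorem4p6 (d : measure_display) (T : measurableType d)
    (R : realType) (P : probability T R) (N : nat)
    (X : 'rV[R]_N -> {RV P >-> R})
    (F : {measure set (borel_rV R N) -> \bar R}) (v : 'rV[R]_N -> R)
    (X_gaussian : gaussian_field X)
    (X_centered : centered X)
    (X_stationary : stationary_increments X)
    (X_0 : \forall w \ae P, X 0 w = 0)
    (X_cov_continuous :
      continuous (fun st : 'rV[R]_N * 'rV[R]_N =>
        covariance_function X st.1 st.2))
    (F_spectral : spectral_measure F)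
    (X_spectral : spectral_representation X F)
    (v_variogram : is_variogram X v)
    (v_C2 : continuous_second_partials v) :
  forall t : 'rV[R]_N, ms_differentiable X t.
Proof.
move=> t.
have /choice[Y YP] (i : 'I_N) : exists Y : T -> R,
    measurable_fun setT Y /\ forall eps : R, 0 < eps ->
    exists2 delta, 0 < delta & forall (s : 'rV[R]_N) (a : R),
    `|s - t| < delta -> `|a| < delta ->
    ('E_P[fun w => ((X (s + a *: delta_mx 0 i) w - X s w - a * Y w) ^+ 2)%R]
     <= (eps * a ^+ 2)%:E)%E.
  have [Y mY HY] := partial_ms_derivative_locally_uniform v_variogram v_C2 t i.
  by exists Y.
have mY i : measurable_fun setT (Y i) := (YP i).1.
pose G0 : T -> borel_rV R N := fun w => \row_i Y i w.
have mG0 : measurable_fun setT G0 by exact: measurable_fun_row.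
pose G : {RV P >-> borel_rV R N} :=
  HB.pack G0 (isMeasurableFun.Build _ _ _ _ G0 mG0).
exists G => u _.
(* [t + h *: S k] are the vertices of the coordinate path from [t] to
   [t + h *: u]. *)
pose S k : 'rV[R]_N := \sum_(j < N | (j < k)%N) u 0 j *: delta_mx 0 j.
(* The linearization error on the [k]-th leg of the path, divided by [h]. *)
pose f (k : 'I_N) h w := (X (t + h *: S k + (h * u 0 k) *: delta_mx 0 k) w
  - X (t + h *: S k) w - h * u 0 k * Y k w) / h.
have f_null k : ms_null P (f k).
  split=> [h|eps eps0].
    apply: measurable_funM => //; apply: measurable_funB.
      by apply: measurable_funB; exact: measurable_rv.
    exact: measurable_funM.
  (* Tolerance [eps / (1 + u_k^2)] turns into [eps * u_k^2 / (1 + u_k^2) <= eps] after division by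
     [h^2], also for [u_k = 0]. *)
  have u1 : 0 < 1 + u 0 k ^+ 2 by rewrite ltr_pwDl // sqr_ge0.
  have [delta delta0 HY] := (YP k).2 _ (divr_gt0 eps0 u1).
  (* [h * C < delta] keeps both the displacement [h *: S k] of the base point and the step
     [h * u 0 k] below [delta]. *)
  pose C := 1 + `|S k| + `|u 0 k|.
  have C0 : 0 < C by rewrite /C -addrA ltr_pwDl // addr_ge0.
  near=> h.
  have h0 : 0 < h by near: h; exact: nbhs_right_gt.
  have hC : h * C < delta.
    rewrite -ltr_pdivlMr //; near: h; apply: nbhs_right_lt; exact: divr_gt0.
  have sdelta : `|t + h *: S k - t| < delta.
    rewrite addrC addKr normrZ gtr0_norm // (le_lt_trans _ hC) // ler_pM2l //.
    by rewrite /C addrAC lerDr addr_ge0.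
  have adelta : `|h * u 0 k| < delta.
    rewrite normrM gtr0_norm // (le_lt_trans _ hC) // ler_pM2l //.
    by rewrite /C lerDr addr_ge0.
  rewrite (_ : (fun _ => _) = fun w => h ^- 2 *
    (X (t + h *: S k + (h * u 0 k) *: delta_mx 0 k) w
     - X (t + h *: S k) w - h * u 0 k * Y k w) ^+ 2); last first.
    by apply/funext => w; rewrite /f exprMn exprVn mulrC.
  rewrite ge0_expectationZl ?invr_ge0 ?sqr_ge0 //; last first.
  - by move=> w; exact: sqr_ge0.
  - apply: measurable_fun_sqr; apply: measurable_funB.
      by apply: measurable_funB; exact: measurable_rv.
    exact: measurable_funM.
  apply: (@le_trans _ _ ((h ^- 2)%:E *
    (eps / (1 + u 0 k ^+ 2) * (h * u 0 k) ^+ 2)%:E)%E).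
    by rewrite lee_pmul2l ?lte_fin ?invr_gt0 ?exprn_gt0 //; exact: HY.
  rewrite -EFinM lee_fin.
  rewrite (_ : h ^- 2 * _ = eps * (u 0 k ^+ 2 / (1 + u 0 k ^+ 2))); last first.
    by field; rewrite !gt_eqF.
  by apply: ler_piMr; [exact: ltW|rewrite ler_pdivrMr // mul1r lerDr].
have S_last : S N = u.
  by rewrite /S [RHS]row_sum_delta; apply: eq_bigl => j; rewrite ltn_ord.
have S_step (k : 'I_N) : S k.+1 = S k + u 0 k *: delta_mx 0 k.
  rewrite /S (bigD1 k) //= addrC; congr (_ + _); apply: eq_bigl => j.
  by rewrite ltnS ltn_neqAle andbC.
(* The increments of [X] along the legs telescope from [S 0 = 0] to [S N = u], and the linear terms
   add up to [h * dot u (G w)]. *)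
have fE h w : (X (t + h *: u) w - X t w - h * dot u (G w)) / h =
    \sum_(k < N) f k h w.
  rewrite -mulr_suml sumrB; congr ((_ - _) / h).
    rewrite (eq_bigr (fun k : 'I_N =>
      X (t + h *: S k.+1) w - X (t + h *: S k) w)); last first.
      by move=> k _; rewrite S_step scalerDr scalerA addrA.
    rewrite -(big_mkord xpredT
      (fun k => X (t + h *: S k.+1) w - X (t + h *: S k) w)).
    rewrite (telescope_sumr (fun k => X (t + h *: S k) w)) // S_last.
    by rewrite /S big_pred0 // scaler0 addr0.
  rewrite /dot mxE mulr_sumr; apply: eq_bigr => k _.
  by rewrite !mxE mulrA.
have := ms_null_cvg (ms_null_sum (index_enum 'I_N) f_null).
apply: cvg_trans; apply: near_eq_cvg; apply: nearW => h.
by congr 'E_P[_]%E; apply/funext => w; rewrite fE.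
Unshelve. all: by end_near. Qed.
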